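(* Let $1\leq p<\infty$. There exists a continuous function $f:[0,1]\to\mathcal{L}^p(\Omega)$, $t\mapsto f_t$, such that for all measurable sets $T\subset[0,1]$ with $\mu(T)>0$ and every $t\in T$ at which $T$ has Lebesgue density one, there exists a sequence $(t_n)_{n\in\mathbb{N}}\subset T$ with $\lim_{n\to\infty}t_n=t$ and $\lambda(A_t)=1$, where $$A_t=\{x\in\Omega:\ \lim_{n\to\infty}f_{t_n}(x)\neq f_t(x)\},$$ i.e. $A_t$ is the set of $x\in\Omega$ for which it is not the case that $f_{t_n}(x)$ converges to $f_t(x)$ as $n\to\infty$.
   Context: $\Omega=[0,1]$ is the space domain, with Borel $\sigma$-field and Lebesgue measure, denoted $\lambda$. The index set $[0,1]$ carries its usual topology and Lebesgue measure, denoted $\mu$. $\mathcal{L}^p(\Omega)$ is the space of real-valued $p$-integrable functions on $\Omega$, where almost everywhere equal functions are NOT identified, equipped with the topology induced by the seminorm $\|\cdot\|_p$; continuity of $f:[0,1]\to\mathcal{L}^p(\Omega)$ is with respect to this topology. *)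

(* Defs.v *)
From HB Require Import structures.
From mathcomp Require Import all_boot all_order all_algebra.
From mathcomp Require Import all_classical all_reals all_analysis.
From mathcomp Require Import measurable_realfun.

Set Implicit Arguments.
Unset Strict Implicit.
Unset Printing Implicit Defensive.

Import Order.TTheory GRing.Theory Num.Theory.
Import numFieldNormedType.Exports.

Local Open Scope classical_set_scope.
Local Open Scope ring_scope.

(* [LfunType mu p1] is the space of p-integrable functions before the quotient
   by almost everywhere equality; it comes without a topology. The following
   equips it with the (non-Hausdorff) topology of the seminorm. *)
Section Lfun_seminorm_topology.
Context d (T : measurableType d) (R : realType).
Variables (mu : {measure set T -> \bar R}) (p : \bar R) (p1 : (1 <= p)%E).

Definition Lfun_seminorm (f : LfunType mu p1) : R :=
  fine ('N[mu]_p[EFin \o f])%E.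

Definition Lfun_ball (f : LfunType mu p1) (e : R) : set (LfunType mu p1) :=
  [set g | Lfun_seminorm (f - g) < e].

Definition Lfun_entourage : set_system (LfunType mu p1 * LfunType mu p1) :=
  entourage_ Lfun_ball.

HB.instance Definition _ :=
  hasNbhs.Build (LfunType mu p1) (nbhs_ Lfun_entourage).

Lemma Lfun_ball_center f (e : R) : 0 < e -> Lfun_ball f e f.
Proof.
move=> e0; rewrite /Lfun_ball /= subrr /Lfun_seminorm.
rewrite (_ : EFin \o _ = cst 0%E)// Lnorm0//.
by rewrite gt_eqF// (lt_le_trans _ p1)// lte01.
Qed.

Lemma Lfun_ball_sym f g (e : R) : Lfun_ball f e g -> Lfun_ball g e f.
Proof. by rewrite /Lfun_ball /= -opprB /Lfun_seminorm LnormrN. Qed.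

Lemma Lfun_ball_triangle f g h (e1 e2 : R) :
  Lfun_ball f e1 g -> Lfun_ball g e2 h -> Lfun_ball f (e1 + e2) h.
Proof.
rewrite /Lfun_ball /= => fg gh; have -> : f - h = (f - g) + (g - h).
  by rewrite addrA subrK.
by rewrite (le_lt_trans (ler_LnormD _ _))// ltrD.
Qed.

HB.instance Definition _ := @Nbhs_isPseudoMetric.Build R (LfunType mu p1)
  Lfun_entourage erefl Lfun_ball Lfun_ball_center Lfun_ball_sym
  Lfun_ball_triangle erefl.

End Lfun_seminorm_topology.

Section unit_interval.
Context {R : realType}.

(* Lebesgue measure on [0, 1], presented as a measure on the Borel sets of R
   that vanishes outside [0, 1]. A Borel function on [0, 1] is represented by
   a Borel extension to R: the seminorms defined by this measure only depend
   on the values on [0, 1]. *)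
Definition lambda01 : set (measurableTypeR R) -> \bar R :=
  mrestr lebesgue_measure (measurable_itv `[(0 : R), 1]).

HB.instance Definition _ := Measure.on lambda01.

Definition lebesgue_measurable : set (set R) :=
  completed_algebra_gen (@lebesgue_measure R).

(* The density is relative to the space [0, 1]: the balls are those of [0, 1],
   so that the one-sided density is meant at the endpoints. *)
Definition density_one (T : set R) (t : R) : Prop :=
  let mu (A : set R) := completed_lebesgue_measure A in
  let B r := `[0, 1]%classic `&` ball t r in
  (mu (T `&` B r) * (mu (B r))^-1)%E @[r --> 0^'+] --> 1%E.

End unit_interval.

(* Main.v *)
Require Import Defs.
From mathcomp Require Import all_boot all_order all_algebra.
From mathcomp Require Import all_classical all_reals all_analysis.
From mathcomp Require Import measurable_realfun.
From mathcomp Require Import lra ring.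

Set Implicit Arguments.
Unset Strict Implicit.
Unset Printing Implicit Defensive.

Import Order.TTheory GRing.Theory Num.Theory.
Import numFieldNormedType.Exports.

Local Open Scope classical_set_scope.
Local Open Scope ring_scope.

(** Consider, in the (t, x) plane, for each [k] the lines [x = 2 ^ k * t - i]
    with [i < 2 ^ k], thickened to strips of half-width [4 ^- k]. Over every
    dyadic time interval of length [2 ^- k] one of these lines climbs from 0
    to 1. Let [f t x] be the supremum of the levels [1 - 1 / (k + 1)] over the
    [k] such that (t, x) is in a strip of index [k].

    Continuity. The section at time [t] of the strips of index [k] has measure
    at most [2 / 2 ^ k], and changes between [s] and [t] on a set of measure at
    most [4 * 4 ^ k * |s - t|]. Hence the functions [f s] and [f t] differ
    only on a set of measure tending to 0 as [s] tends to [t]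
    ([measure_variation_set_small]), and since they take values in [0, 1] they
    are close in every L^p ([profile_Lfun_continuous]).

    Failure of convergence. By Borel-Cantelli, almost every [x] is in finitely
    many strips at time [t], which means [f t x < 1] ([profile_lt1],
    [measure_limsup_strip]). On the other hand, let [T] have density one at
    [t], cut the space interval into [4 ^ k] cells, and cut the dyadic interval
    of [t] into the corresponding time cells, during which the line is in
    a given space cell. A time of [T] in a time cell puts the whole space cell
    in the strip. The time cells without a point of [T] fill a part of a ball
    around [t] in the complement of [T], hence a vanishing proportion of it;
    as the line is affine, the corresponding space cells have a measure
    tending to 0 ([measure_missed_space_le]). One point of [T] in each of the
    other time cells, for all scales, forms a sequence that tends to [t]
    ([hitting_sequence]), and almost every [x] is covered at infinitely many
    scales, so that the upper limit of the values at [x] is 1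
    ([profile_not_cvg]). *)

(** * Union bounds *)

Section union_bounds.
Context d (T : measurableType d) (R : realType) (mu : {measure set T -> \bar R}).

Lemma measure_bigcup_ltn_le (n : nat) (A : nat -> set T) (c : R) :
  (forall i, measurable (A i)) ->
  (forall i, (i < n)%N -> (mu (A i) <= c%:E)%E) ->
  (mu (\bigcup_(i in `I_n) A i) <= (n%:R * c)%:E)%E.
Proof.
move=> mA Ac; rewrite bigcup_mkord.
apply: (le_trans (Boole_inequality mu (fun i _ => mA i))).
apply: (@le_trans _ _ (\sum_(i < n) c%:E)%E).
  by apply: lee_sum => i _; exact: Ac.
by rewrite sumEFin lee_fin sumr_const card_ord mulr_natl.
Qed.

Lemma measure_bigcup_geq_le (K : nat) (A : nat -> set T) (c : R) : 0 <= c ->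
  (forall k, measurable (A k)) ->
  (forall k, (mu (A k) <= (c / 2 ^+ k)%:E)%E) ->
  (mu (\bigcup_(k in [set k | (K <= k)%N]) A k) <= (2 * c / 2 ^+ K)%:E)%E.
Proof.
move=> c0 mA Ac.
have sub : \bigcup_(k in [set k | (K <= k)%N]) A k
    `<=` \bigcup_n A (K + n)%N.
  by move=> x [k /= Kk Akx]; exists (k - K)%N => //; rewrite subnKC.
apply: (@le_trans _ _ (\sum_(0 <= n <oo) mu (A (K + n)%N))%E).
  by apply: (measure_sigma_subadditive mu) => //; exact: bigcup_measurable.
apply: le_trans (epsilon_trick0 xpredT _); last first.
  by rewrite divr_ge0// ?mulr_ge0// exprn_ge0.
apply: lee_nneseries => // n _; apply: le_trans (Ac _) _.
rewrite lee_fin natrX exprS exprD [leRHS](_ : _ = c / (2 ^+ K * 2 ^+ n))//.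
have : (2 : R) ^+ K != 0 by rewrite expf_neq0.
have : (2 : R) ^+ n != 0 by rewrite expf_neq0.
by move=> ? ?; field; apply/andP.
Qed.

End union_bounds.

(** * Steep strips *)

Section strips.
Context {R : realType}.
Implicit Types (t s x : R) (k i : nat).
Notation mu := (@lebesgue_measure R).

(** The section at time [t] of [2 ^ k] steep strips around the lines
    [x = 2 ^ k * t - i] in the (t, x) plane. Each line climbs from 0 to 1
    while [t] crosses the [i]-th dyadic interval of length [2 ^- k], so some
    strip sweeps all of the space interval near every time. The half-width
    [4 ^- k] is small enough for the [2 ^ k] sections together to have a
    summable measure, without asking which of them meet [0, 1]. *)
Definition strip k t : set R := \bigcup_(i in `I_(2 ^ k))
  `[2 ^+ k * t - i%:R - 4 ^- k, 2 ^+ k * t - i%:R + 4 ^- k]%classic.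

Lemma measurable_strip k t : measurable (strip k t).
Proof. by apply: bigcup_measurable => i _; exact: measurable_itv. Qed.

Lemma pow2_neq0 k : (2 : R) ^+ k != 0.
Proof. by rewrite expf_neq0. Qed.

Lemma cvg_pow2V : (fun k => (2 : R) ^- k) @ \oo --> (0 : R).
Proof.
under eq_fun do rewrite -exprVn.
by apply: cvg_expr; rewrite ger0_norm ?invf_lt1 ?ltr1n.
Qed.

Lemma pow4E k : (4 : R) ^+ k = 2 ^+ k * 2 ^+ k.
Proof. by rewrite -exprMn -natrM. Qed.

Lemma lebesgue_measure_itv_bounded (b b' : bool) (x y : R) : x <= y ->
  mu [set` Interval (BSide b x) (BSide b' y)] = (y - x)%:E.
Proof.
rewrite lebesgue_measure_itv /= lte_fin -EFinD.
by case: ltgtP => // -> _; rewrite subrr.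
Qed.

Lemma measure_strip_le k t : (mu (strip k t) <= (2 / 2 ^+ k)%:E)%E.
Proof.
rewrite (_ : 2 / 2 ^+ k = (2 ^ k)%:R * (2 * 4 ^- k)); last first.
  by rewrite natrX pow4E; have := pow2_neq0 k => ?; field.
apply: measure_bigcup_ltn_le => [i|i _]; first exact: measurable_itv.
have ? : 0 <= (4 : R) ^- k by rewrite invr_ge0 exprn_ge0.
rewrite [leLHS]lebesgue_measure_itv_bounded ?lee_fin; lra.
Qed.

Lemma measure_tail_strip_le K t :
  (mu (\bigcup_(k in [set k | (K <= k)%N]) strip k t) <= (4 / 2 ^+ K)%:E)%E.
Proof.
rewrite (_ : 4 = 2 * 2); last by rewrite -natrM.
apply: measure_bigcup_geq_le => // k; first exact: measurable_strip.
exact: measure_strip_le.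
Qed.

(** The two endpoints of an interval of [strip k] move by [2 ^ k * |s - t|]
    between the times [t] and [s]; these are the neighbourhoods of that size
    of the endpoints at time [t]. *)
Definition strip_edges k s t : set R := \bigcup_(i in `I_(2 ^ k))
  let a := 2 ^+ k * t - i%:R in let h := 2 ^+ k * `|s - t| in
  (`[a - 4 ^- k - h, a - 4 ^- k + h] `|` `[a + 4 ^- k - h, a + 4 ^- k + h]).

Lemma measurable_strip_edges k s t : measurable (strip_edges k s t).
Proof.
by apply: bigcup_measurable => i _; apply: measurableU; exact: measurable_itv.
Qed.

Lemma measure_strip_edges_le k s t :
  (mu (strip_edges k s t) <= (4 * 4 ^+ k * `|s - t|)%:E)%E.
Proof.
rewrite (_ : 4 * 4 ^+ k * `|s - t| = 
  (2 ^ k)%:R * (4 * (2 ^+ k * `|s - t|))); last first.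
  by rewrite natrX pow4E; ring.
apply: measure_bigcup_ltn_le => [i|i _].
  by apply: measurableU; exact: measurable_itv.
apply: le_trans (measureU2 _ _ _) _; [exact: measurable_itv..|].
have ? : 0 <= 2 ^+ k * `|s - t| by rewrite mulr_ge0// exprn_ge0.
rewrite [X in (X + _)%E]lebesgue_measure_itv_bounded
  ?[X in (_ + X)%E]lebesgue_measure_itv_bounded -?EFinD ?lee_fin; lra.
Qed.

(** For two intervals of equal length whose centres are [h] apart, a point of
    only one of them is within [h] of an endpoint of the other. *)
Lemma strip_sub_edges k s t x :
  ~ (strip k s x <-> strip k t x) -> strip_edges k s t x.
Proof.
apply: contra_notP => xE.
have hs : 2 ^+ k * s = 2 ^+ k * t + 2 ^+ k * (s - t) by ring.
have : `|2 ^+ k * (s - t)| <= 2 ^+ k * `|s - t|.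
  by rewrite normrM ger0_norm// exprn_ge0.
rewrite ler_norml => /andP[h1 h2].
have H i : (i < 2 ^ k)%N ->
    `[2 ^+ k * s - i%:R - 4 ^- k, 2 ^+ k * s - i%:R + 4 ^- k]%classic x <->
    `[2 ^+ k * t - i%:R - 4 ^- k, 2 ^+ k * t - i%:R + 4 ^- k]%classic x.
  move=> ik; have nE : ~ (let a := 2 ^+ k * t - i%:R in
      let h := 2 ^+ k * `|s - t| in
      (`[a - 4 ^- k - h, a - 4 ^- k + h] `|`
       `[a + 4 ^- k - h, a + 4 ^- k + h])%classic x).
    by move=> xEi; apply: xE; exists i.
  rewrite /= !in_itv/= hs; move: nE => /= /not_orP[].
  rewrite !in_itv/= => /negP n1 /negP n2; move: n1 n2 h1 h2.
  set h := 2 ^+ k * _; set e := 4 ^- k; set g := _ * `| _ |.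
  rewrite !negb_and -!ltNge => /orP[] n1 /orP[] n2 h1 h2;
    split=> /andP[? ?]; apply/andP; split; lra.
by split=> -[i ik xi]; exists i => //; apply/H.
Qed.

End strips.

(** * The profile functions *)

Section profile.
Context {R : realType}.
Implicit Types (t s x : R) (k i : nat).
Notation mu := (@lebesgue_measure R).

Definition level k : R := 1 - k.+1%:R^-1.

Lemma level_ge0 k : 0 <= level k.
Proof. by rewrite subr_ge0 invf_le1// ler1n. Qed.

Lemma level_lt1 k : level k < 1.
Proof. by rewrite ltrBlDr ltrDl invr_gt0. Qed.

Lemma le_level k i : (k <= i)%N -> level k <= level i.
Proof. by move=> ki; rewrite lerD2l lerN2 lef_pV2 ?posrE ?ltr0n// ler_nat ltnS. Qed.

Lemma level_cvg1 : level @ \oo --> (1 : R).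
Proof.
rewrite -[X in _ --> X]subr0; apply: cvgB; first exact: cvg_cst.
exact: cvg_harmonic.
Qed.

(** Any bounded measurable function of the set of [k] with [x] in [strip k t]
    would give an L^p-continuous map. The supremum of levels that increase to 1
    without attaining it is below 1 when that set is finite, and close to 1 as
    soon as one large [k] belongs to it: this gap is what excludes
    convergence. *)
Definition profile t x : R := sups (fun k => level k * \1_(strip k t) x) 0%N.

Lemma profile_ubound t x :
  has_ubound (range (fun k => level k * \1_(strip k t) x)).
Proof.
exists 1 => _ [k _ <-]; rewrite indicE; case: (x \in _); rewrite ?mulr1 ?mulr0//.
exact/ltW/level_lt1.
Qed.

Lemma measurable_profile t : measurable_fun setT (profile t).
Proof.
apply: measurable_fun_sups => [x _|k]; first exact: profile_ubound.
apply: measurable_funM; first exact: measurable_cst.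
by apply: measurable_indic; exact: measurable_strip.
Qed.

Lemma profile_le t x (c : R) : 0 <= c ->
  (forall k, strip k t x -> level k <= c) -> profile t x <= c.
Proof.
move=> c0 H; apply: ge_sup; first by exists (level 0 * \1_(strip 0 t) x), 0%N.
move=> _ [k _ <-]; rewrite indicE.
by case: (boolP (x \in _)) => [/set_mem/H|_]; rewrite ?mulr1 ?mulr0.
Qed.

Lemma ub_le_profile k t x : level k * \1_(strip k t) x <= profile t x.
Proof.
apply: (@ub_le_sup _ (sdrop (fun i => level i * \1_(strip i t) x) 0%N)).
  exact/has_ubound_sdrop/profile_ubound.
by exists k.
Qed.

Lemma level_le_profile k t x : strip k t x -> level k <= profile t x.
Proof.
move=> xk; apply: le_trans (ub_le_profile k t x).
by rewrite indicE mem_set// mulr1.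
Qed.

Lemma profile_ge0 t x : 0 <= profile t x.
Proof.
by apply: le_trans (ub_le_profile 0%N t x); rewrite mulr_ge0// level_ge0.
Qed.

Lemma profile_le1 t x : profile t x <= 1.
Proof. by apply: profile_le => // k _; exact/ltW/level_lt1. Qed.

(** If [x] is in no strip of index at least [K], then the supremum is bounded
    by [level K]. *)
Lemma profile_lt1 t x : ~ lim_sup_set (strip ^~ t) x -> profile t x < 1.
Proof.
rewrite /lim_sup_set => /existsNP[K /not_implyP[_ nx]].
apply: le_lt_trans (level_lt1 K); apply: profile_le => [|k xk].
  exact: level_ge0.
by apply: le_level; rewrite leqNgt; apply/negP => /ltnW Kk; apply: nx; exists k.
Qed.

(** Borel-Cantelli. *)
Lemma measure_limsup_strip t : mu (lim_sup_set (strip ^~ t)) = 0%E.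
Proof.
apply: lim_sup_set_cvg0 => [k|]; first exact: measurable_strip.
apply: (@le_lt_trans _ _ 4%:E); last exact: ltry.
apply: le_trans (epsilon_trick0 xpredT _); last by [].
apply: lee_nneseries => // k _; apply: le_trans (measure_strip_le _ _) _.
rewrite lee_fin natrX exprS.
by rewrite (_ : 4 / (2 * 2 ^+ k) = 2 / 2 ^+ k)//; have := pow2_neq0 k => ?; field.
Qed.

(** Between two times, the strips of index below [K] change only near their
    endpoints, at a cost proportional to [|s - t|]; those of larger index may
    change completely, but they have a small measure at every time. *)
Definition variation_set K s t : set R :=
  \bigcup_(k in `I_K) strip_edges k s t `|`
  (\bigcup_(k in [set k | (K <= k)%N]) strip k s `|`
   \bigcup_(k in [set k | (K <= k)%N]) strip k t).

Lemma measurable_variation_set K s t : measurable (variation_set K s t).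
Proof.
apply: measurableU; [|apply: measurableU]; apply: bigcup_measurable => k _.
- exact: measurable_strip_edges.
- exact: measurable_strip.
- exact: measurable_strip.
Qed.

Lemma profile_eq_off K s t x :
  ~ variation_set K s t x -> profile s x = profile t x.
Proof.
move=> nx; rewrite /profile; congr (sups _ 0%N); apply/funext => k.
suff H : strip k s x <-> strip k t x.
  congr (_ * _); rewrite !indicE.
  by have [/set_mem/H/mem_set->//|/negP xs] := boolP (x \in strip k s);
    case: (boolP (x \in strip k t)) => // /set_mem/H/mem_set /xs.
apply: contra_notP nx => xst; have [Kk|kK] := leqP K k; last first.
  by left; exists k => //; exact: strip_sub_edges.
right; have [xs|xs] := pselect (strip k s x); first by left; exists k.
right; exists k => //; apply: contra_notP xst => xt.
by split.
Qed.

Lemma measure_variation_set_le K s t :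
  (mu (variation_set K s t) <=
   (K%:R * (4 * 4 ^+ K * `|s - t|) + 8 / 2 ^+ K)%:E)%E.
Proof.
rewrite (_ : 8 / 2 ^+ K = 4 / 2 ^+ K + 4 / 2 ^+ K); last by lra.
rewrite !EFinD.
have mE : measurable (\bigcup_(k in `I_K) strip_edges k s t).
  by apply: bigcup_measurable => k _; exact: measurable_strip_edges.
have mS r : measurable (\bigcup_(k in [set k | (K <= k)%N]) strip k r).
  by apply: bigcup_measurable => k _; exact: measurable_strip.
apply: le_trans (measureU2 _ _ _) _; [exact: mE|by apply: measurableU; exact: mS|].
apply: leeD; last first.
  apply: le_trans (measureU2 _ _ _) _; [exact: mS..|].
  by apply: leeD; exact: measure_tail_strip_le.
apply: measure_bigcup_ltn_le => [k|k kK]; first exact: measurable_strip_edges.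
apply: le_trans (measure_strip_edges_le _ _ _) _; rewrite lee_fin.
by rewrite ler_wpM2r// ler_wpM2l// ler_weXn2l ?ler1n// ltnW.
Qed.

Lemma measure_variation_set_small t (e : R) : 0 < e ->
  \forall s \near t, exists K, (mu (variation_set K s t) < e%:E)%E.
Proof.
move=> e0.
have [K _ KP] : \forall K \near \oo, (8 : R) / 2 ^+ K < e / 2.
  have : (fun K : nat => (8 : R) / 2 ^+ K) @ \oo --> (0 : R).
    rewrite -[X in _ --> X](mulr0 8); apply: cvgM; [exact: cvg_cst|].
    exact: cvg_pow2V.
  by move/cvgr_lt; apply; rewrite divr_gt0.
have KE := KP K (leqnn K).
pose C : R := K%:R * (4 * 4 ^+ K).
have C0 : 0 <= C by rewrite !mulr_ge0// exprn_ge0.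
have d0 : 0 < e / 2 / (C + 1) by rewrite !divr_gt0// ltr_wpDl.
near=> s; exists K; apply: le_lt_trans (measure_variation_set_le _ _ _) _.
have st : `|s - t| < e / 2 / (C + 1).
  by rewrite distrC; near: s; exact: (@nbhsx_ballx _ _ t _ d0).
rewrite lte_fin mulrA -/C (splitr e); apply: ltr_leD => //; last exact: ltW.
apply: (@le_lt_trans _ _ ((C + 1) * `|s - t|)).
  by rewrite ler_wpM2r// lerDl.
by rewrite mulrC -ltr_pdivlMr// ltr_wpDl.
Unshelve. all: by end_near. Qed.

End profile.

(** * Continuity in the seminorm of order p *)

Section Lnorm_bounded.
Context d (T : measurableType d) (R : realType) (mu : {measure set T -> \bar R}).

Lemma Lnorm_le_support (p : R) (g : T -> R) (D : set T) : 1 <= p ->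
  measurable_fun setT g -> measurable D ->
  (forall x, `|g x| <= \1_D x) ->
  ('N[mu]_p%:E[EFin \o g] <= mu D `^ p^-1)%E.
Proof.
move=> p1 mg mD gD; have p0 : 0 < p by rewrite (lt_le_trans _ p1).
rewrite unlock /=; apply: gt0_ler_poweR.
- by rewrite invr_ge0 ltW.
- by rewrite in_itv/= leey andbT; apply: integral_ge0 => x _;
  rewrite lee_fin powR_ge0.
- by rewrite in_itv/= leey andbT.
have -> : mu D = (\int[mu]_x (\1_D x)%:E)%E by rewrite integral_indic// setIT.
apply: ge0_le_integral => //.
- apply/measurable_EFinP.
  apply: (@measurableT_comp _ _ _ _ _ _ (@powR R ^~ p)); first exact: measurable_powR.
  exact: measurableT_comp.
- by apply/measurable_EFinP; exact: measurable_indic.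
move=> x _; rewrite lee_fin.
have -> : (\1_D x : R) = \1_D x `^ p.
  by rewrite indicE; case: (_ \in _); rewrite ?powR1// powR0// gt_eqF.
by apply: ge0_ler_powR; rewrite ?nnegrE// ltW.
Qed.

End Lnorm_bounded.

Section profile_Lfun.
Context {R : realType} (p : R) (p1 : (1 <= p%:E)%E).

Lemma lambda01_le (D : set R) : measurable D ->
  (lambda01 D <= lebesgue_measure D)%E.
Proof.
by move=> mD; apply: le_measure; rewrite ?inE//; exact: measurableI.
Qed.

Lemma profile_in_Lfun t : profile t \in @Lfun _ _ R (@lambda01 R) p%:E.
Proof.
have mf := @measurable_profile R t.
rewrite inE/=; apply/andP; split; rewrite inE//= /finite_norm.
apply: (@le_lt_trans _ _ (lambda01 setT `^ p^-1)%E).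
  apply: Lnorm_le_support => // x.
  by rewrite indicT/= ger0_norm ?profile_ge0 ?profile_le1.
apply: poweR_lty; rewrite /lambda01 /mrestr setTI.
by rewrite [ltLHS]lebesgue_measure_itv_bounded ?ltry.
Qed.

Definition profile_Lfun (t : R) : LfunType (@lambda01 R) p1 :=
  Lfun_Sub p1 (profile_in_Lfun t).

(** Profiles lie in [0, 1], so that the p-th power of the seminorm of a
    difference is at most the measure of the set where the profiles differ,
    for every exponent. *)
Lemma profile_Lfun_continuous : continuous profile_Lfun.
Proof.
move=> t; apply/cvg_ballP => e e0.
have ep0 : 0 < (e / 2) `^ p by rewrite powR_gt0// divr_gt0.
near=> s.
have [K KE] : exists K,
    (lebesgue_measure (variation_set K s t) < ((e / 2) `^ p)%:E)%E.
  by near: s; exact: measure_variation_set_small.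
rewrite /ball/= /Lfun_ball/= /Lfun_seminorm.
set D := variation_set K s t in KE *.
have mD : measurable D by exact: measurable_variation_set.
have lt_e : ('N[lambda01]_p%:E[EFin \o (profile_Lfun t - profile_Lfun s)%R] <
    e%:E)%E.
  apply: (@le_lt_trans _ _ (lambda01 D `^ p^-1)%E).
    apply: Lnorm_le_support => //.
    move=> x; have -> : (profile_Lfun t - profile_Lfun s)%R x =
      profile t x - profile s x by [].
    rewrite indicE; have [xD|/negP xD] := boolP (x \in D).
      rewrite -[true%:R]/(1 : R) ler_norml.
      have := profile_ge0 t x; have := profile_le1 t x.
      by have := profile_ge0 s x; have := profile_le1 s x => *; apply/andP; split; lra.
    rewrite (@profile_eq_off _ K s t) ?subrr ?normr0// => /mem_set.
    exact: xD.
  have p0 : 0 < p by rewrite (@lt_le_trans _ _ 1).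
  apply: (@le_lt_trans _ _ (((e / 2) `^ p)%:E `^ p^-1)%E).
    apply: gt0_ler_poweR.
    - by rewrite invr_ge0 ltW.
    - by rewrite in_itv/= leey andbT.
    - by rewrite in_itv/= leey andbT lee_fin ltW.
    - exact: le_trans (lambda01_le mD) (ltW KE).
  rewrite poweR_EFin lte_fin -powRrM mulfV ?gt_eqF// powRr1 ?divr_ge0 ?ltW//.
  by rewrite ltr_pdivrMr// mulr_natr mulr2n ltrDl.
rewrite -lte_fin; apply: le_lt_trans lt_e.
by rewrite finite_norm_fine.
Unshelve. all: by end_near. Qed.

End profile_Lfun.

(** * Cells missed by a set of times *)

Section hitting.
Context {R : realType}.
Implicit Types (t s x : R) (k i j : nat) (T : set R).
Notation mu := (@lebesgue_measure R).

(** As a function on all sets, [lebesgue_measure] is the outer measure that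
    extends the length, hence it is monotone without measurability. *)
Lemma le_lebesgue_measure (A B : set R) : A `<=` B -> (mu A <= mu B)%E.
Proof. by move=> AB; apply: (@le_mu_ext _ (ocitv_type R) R _ A B). Qed.

(** Caratheodory's criterion, which provides additivity on sets [A] that are
    not Borel. *)
Lemma lebesgue_measure_split (A V : set R) : measurable V ->
  mu A = (mu (A `&` V) + mu (A `&` ~` V))%E.
Proof.
by move=> mV; exact: (@sub_caratheodory _ (ocitv_type R) R (wlength idfun) V mV A).
Qed.

Definition space_cell k j : set R :=
  `[j%:R * 4 ^- k, j.+1%:R * 4 ^- k[%classic.

(** The times at which the [i]-th line of scale [k] is in the [j]-th space
    cell: an interval of length [8 ^- k]. *)
Definition time_cell k i j : set R :=
  [set s | space_cell k j (2 ^+ k * s - i%:R)].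

Lemma time_cellE k i j : time_cell k i j =
  `[(i%:R + j%:R * 4 ^- k) / 2 ^+ k, (i%:R + j.+1%:R * 4 ^- k) / 2 ^+ k[%classic.
Proof.
have P0 : 0 < (2 : R) ^+ k by rewrite exprn_gt0.
apply/seteqP; split => s; rewrite /time_cell /space_cell /= !in_itv/=;
  by rewrite (ler_pdivrMr _ _ P0) (ltr_pdivlMr _ _ P0) (mulrC s) lerBrDl ltrBlDl.
Qed.

Lemma measurable_time_cell k i j : measurable (time_cell k i j).
Proof. by rewrite time_cellE; exact: measurable_itv. Qed.

Lemma measure_space_cell k j : mu (space_cell k j) = (4 ^- k)%:E.
Proof.
have c0 : (0 : R) < 4 ^- k by rewrite invr_gt0 exprn_gt0.
rewrite /space_cell lebesgue_measure_itv_bounded.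
  by congr EFin; rewrite -natr1; ring.
by rewrite ler_pM2r// ler_nat.
Qed.

Lemma measure_time_cell k i j :
  mu (time_cell k i j) = (4 ^- k / 2 ^+ k)%:E.
Proof.
have c0 : (0 : R) < 4 ^- k by rewrite invr_gt0 exprn_gt0.
have P0 : 0 < (2 : R) ^+ k by rewrite exprn_gt0.
rewrite time_cellE lebesgue_measure_itv_bounded.
  by congr EFin; rewrite -natr1; field; rewrite !gt_eqF// exprn_gt0.
by rewrite ler_pM2r ?invr_gt0// lerD2l ler_pM2r// ler_nat.
Qed.

Lemma trivIset_space_cell k (D : set nat) : trivIset D (space_cell k).
Proof.
have c0 : (0 : R) < 4 ^- k by rewrite invr_gt0 exprn_gt0.
have le j j' x : space_cell k j x -> space_cell k j' x -> (j <= j')%N.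
  rewrite /space_cell/= !in_itv/= => /andP[jx _] /andP[_ xj'].
  by have := le_lt_trans jx xj'; rewrite ltr_pM2r// ltr_nat ltnS.
move=> j j' _ _ [x [xj xj']]; apply/eqP.
by rewrite eqn_leq (le _ _ x)//= (le _ _ x).
Qed.

(** The cells are as long as the half-width of the strips, hence one time of a
    time cell suffices to cover the whole space cell. *)
Lemma time_cell_strip k i j s x : (i < 2 ^ k)%N ->
  time_cell k i j s -> space_cell k j x -> strip k s x.
Proof.
move=> ik; rewrite /time_cell /space_cell/= !in_itv/= -[j.+1]addn1 natrD mulrDl mul1r.
move=> /andP[? ?] /andP[? ?]; exists i => //=; rewrite in_itv/=.
by apply/andP; split; lra.
Qed.

Lemma dyadic_index k t : `[0, 1]%classic t ->
  exists2 i, (i < 2 ^ k)%N & 0 <= 2 ^+ k * t - i%:R <= 1.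
Proof.
rewrite /= in_itv/= => /andP[t0 t1].
have P0 : 0 < (2 : R) ^+ k by rewrite exprn_gt0.
have [tk|tk] := ltP (2 ^+ k * t) (2 ^+ k).
  have Pt0 : 0 <= 2 ^+ k * t by rewrite mulr_ge0// ltW.
  exists (Num.truncn (2 ^+ k * t)).
    by rewrite -(ltr_nat R) natrX (le_lt_trans _ tk)// truncn_le.
  by have := truncn_itv Pt0; rewrite -natr1 => /andP[? /ltW ?]; apply/andP; split; lra.
(* t = 1 belongs only to the last dyadic interval *)
exists (2 ^ k).-1; first by rewrite prednK// expn_gt0.
have -> : ((2 ^ k).-1%:R : R) = 2 ^+ k - 1.
  by rewrite -natrX -[in RHS](@prednK (2 ^ k)) ?expn_gt0// -natr1 addrK.
have ? : 2 ^+ k * t <= 2 ^+ k by rewrite ler_piMr// ltW.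
by apply/andP; split; lra.
Qed.

Lemma time_cell_near k i j s t : 0 <= 2 ^+ k * t - i%:R <= 1 ->
  (j < 4 ^ k)%N -> time_cell k i j s -> `|t - s| <= 2 ^- k.
Proof.
move=> /andP[t1 t2] jk; rewrite /time_cell /space_cell/= in_itv/= => /andP[s1 s2].
have P0 : 0 < (2 : R) ^+ k by rewrite exprn_gt0.
have c0 : (0 : R) < 4 ^- k by rewrite invr_gt0 exprn_gt0.
have s3 : j.+1%:R * 4 ^- k <= (1 : R).
  by rewrite ler_pdivrMr ?exprn_gt0// mul1r -natrX ler_nat.
have s4 : (0 : R) <= j%:R * 4 ^- k by rewrite mulr_ge0// ltW.
rewrite -(ler_pM2l P0) divff ?gt_eqF// -{1}(gtr0_norm P0) -normrM ler_norml.
by rewrite mulrBr; apply/andP; split; lra.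
Qed.

Lemma time_cell_sub01 k i j s : (i < 2 ^ k)%N -> (j < 4 ^ k)%N ->
  time_cell k i j s -> `[0, 1]%classic s.
Proof.
move=> ik jk; rewrite /time_cell /space_cell/= !in_itv/= => /andP[s1 s2].
have P0 : 0 < (2 : R) ^+ k by rewrite exprn_gt0.
have c0 : (0 : R) < 4 ^- k by rewrite invr_gt0 exprn_gt0.
have s3 : j.+1%:R * 4 ^- k <= (1 : R).
  by rewrite ler_pdivrMr ?exprn_gt0// mul1r -natrX ler_nat.
have s4 : (0 : R) <= j%:R * 4 ^- k by rewrite mulr_ge0// ltW.
have i1 : i%:R + 1 <= (2 : R) ^+ k by rewrite natr1 -natrX ler_nat.
have i0 : 0 <= i%:R :> R by [].
by rewrite -(pmulr_rge0 s P0) -[X in _ && X](ler_pM2l P0) mulr1;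
  apply/andP; split; lra.
Qed.

Definition missed_cells T k i : set nat :=
  [set j | (j < 4 ^ k)%N /\ T `&` time_cell k i j = set0].

Definition missed_space T k i : set R :=
  \bigcup_(j in missed_cells T k i) space_cell k j.

Definition missed_time T k i : set R :=
  \bigcup_(j in missed_cells T k i) time_cell k i j.

Lemma finite_missed_cells T k i : finite_set (missed_cells T k i).
Proof. by apply: sub_finite_set (finite_II (4 ^ k)) => j []. Qed.

Lemma measurable_missed_space T k i : measurable (missed_space T k i).
Proof. by apply: bigcup_measurable => j _; exact: measurable_itv. Qed.

Lemma measurable_missed_time T k i : measurable (missed_time T k i).
Proof. by apply: bigcup_measurable => j _; exact: measurable_time_cell. Qed.

(** The lines of scale [k] have slope [2 ^ k]. *)
Lemma measure_missed_space T k i :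
  mu (missed_space T k i) = ((2 ^+ k)%:E * mu (missed_time T k i))%E.
Proof.
rewrite !measure_fin_bigcup//.
- rewrite ge0_mule_fsumr//; apply: eq_fsbigr => j _.
  rewrite [LHS]measure_space_cell [X in (_ * X)%E]measure_time_cell -EFinM.
  by congr EFin; rewrite mulrC divfK// pow2_neq0.
- exact: finite_missed_cells.
- move=> j j' Dj Dj' [s [sj sj']].
  exact: (trivIset_space_cell Dj Dj' (ex_intro _ _ (conj sj sj'))).
- by move=> j _; exact: measurable_time_cell.
- exact: finite_missed_cells.
- exact: trivIset_space_cell.
- by move=> j _; exact: measurable_itv.
Qed.

Lemma missed_time_disjoint T k i s : missed_time T k i s -> ~ T s.
Proof. by move=> [j [_ Tj] sj] Ts; rewrite -[False]/(set0 s) -Tj. Qed.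

(** The missed times are a part of the ball that is disjoint from [T], so they
    take up at most the fraction [e] of it. The ball has measure at most
    [4 / 2 ^ k], and passing from times to space multiplies the measure by the
    slope [2 ^ k]. *)
Lemma measure_missed_space_le T t (e : R) k i : (i < 2 ^ k)%N ->
  0 <= 2 ^+ k * t - i%:R <= 1 ->
  let B := `[0, 1]%classic `&` ball t (2 / 2 ^+ k) in
  ((1 - e)%:E < mu (T `&` B) * (mu B)^-1)%E ->
  (mu (missed_space T k i) <= (4 * e)%:E)%E.
Proof.
move=> ik tk B lt_ratio.
have P0 : 0 < (2 : R) ^+ k by rewrite exprn_gt0.
have r0 : 0 < 2 / (2 : R) ^+ k by rewrite divr_gt0.
have cellB j : (j < 4 ^ k)%N -> time_cell k i j `<=` B.
  move=> jk s sj; split; first exact: time_cell_sub01 sj.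
  rewrite /ball/=; apply: le_lt_trans (time_cell_near tk jk sj) _.
  by rewrite ltr_pMl ?invr_gt0// ltr1n.
have leB : (mu B <= (4 / 2 ^+ k)%:E)%E.
  apply: (@le_trans _ _ (mu (ball t (2 / 2 ^+ k)))).
    by apply: le_lebesgue_measure; exact: subIsetr.
  by rewrite lebesgue_measure_ball ?(ltW r0)// lee_fin; lra.
have B0 : (0 < mu B)%E.
  apply: lt_le_trans (le_lebesgue_measure (cellB 0%N _)).
    by rewrite measure_time_cell lte_fin divr_gt0// invr_gt0 exprn_gt0.
  by rewrite expn_gt0.
have : (mu (T `&` B) + mu (missed_time T k i) <= mu B)%E.
  rewrite (lebesgue_measure_split B (measurable_missed_time T k i)) addeC.
  apply: leeD; apply: le_lebesgue_measure => s.
    by move=> sV; split=> //; case: sV => j [jk _]; exact: cellB.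
  by move=> [Ts Bs]; split=> // /missed_time_disjoint.
rewrite measure_missed_space; move: lt_ratio leB B0.
have := measure_ge0 mu (T `&` B); have := measure_ge0 mu (missed_time T k i).
(* the three measures are finite, because that of B is *)
case: (mu B) => [b| |]//=; case: (mu (T `&` B)) => [m| |]//=;
  case: (mu (missed_time T k i)) => [v| |]//=.
rewrite inver !lee_fin => v0 m0 + b4; rewrite lte_fin => + b0.
rewrite gt_eqF//= lte_fin ltr_pdivlMr// => mb mvb.
have e0 : 0 < e by nra.
rewrite mulrC -ler_pdivlMr//; apply: (@le_trans _ _ (e * b)); first by lra.
by rewrite mulrAC (mulrC _ e) ler_pM2l.
Qed.

Lemma density_scale T t (e : R) : density_one T t -> 0 < e ->
  \forall k \near \oo,
    let B := `[0, 1]%classic `&` ball t (2 / 2 ^+ k) in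
    ((1 - e)%:E < mu (T `&` B) * (mu B)^-1)%E.
Proof.
move=> /cvge_at_rightP dT e0.
have r0 : (fun k => (2 : R) / 2 ^+ k) @ \oo --> (0 : R).
  rewrite -[X in _ --> X](mulr0 2); apply: cvgM; [exact: cvg_cst|].
  exact: cvg_pow2V.
have rgt0 k : 0 < (2 : R) / 2 ^+ k by rewrite divr_gt0// exprn_gt0.
apply: (dT _ (conj rgt0 r0) [set y | (1 - e)%:E < y]%E).
apply: open_nbhs_nbhs; split; first exact: open_ereal_gt_ereal.
by rewrite /= lte_fin ltrBlDr ltrDl.
Qed.

End hitting.

(** * The sequence of times *)

Section sequence_of_times.
Context {R : realType}.
Implicit Types (t s x : R) (k i j : nat) (T : set R).
Notation mu := (@lebesgue_measure R).

(** A sequence that picks, for each scale and each cell, a time of [T] in that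
    time cell if there is one, and [t] otherwise. The integer [4 ^ k + j] with
    [j < 4 ^ k] stands for the [j]-th cell of scale [k]: as each scale has
    finitely many cells, the sequence tends to [t]. *)
Lemma hitting_sequence T t (ix : nat -> nat) : T t ->
  (forall k, 0 <= 2 ^+ k * t - (ix k)%:R <= 1) ->
  exists u : nat -> R,
    [/\ forall n, T (u n),
        u @ \oo --> t &
        forall k j, (j < 4 ^ k)%N -> ~ missed_cells T k (ix k) j ->
          exists2 n, (k <= n)%N & time_cell k (ix k) j (u n)].
Proof.
move=> Tt ixP.
pose target n := let k := trunc_log 4 n in
  [set s | [/\ T s, (n - 4 ^ k < 4 ^ k)%N & time_cell k (ix k) (n - 4 ^ k) s]].
pose u n := xget t (target n); exists u; split.
- by move=> n; rewrite /u; case: xgetP => // y _ [].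
- apply/cvgrPdist_le => e e0.
  have [K _ KP] : \forall K \near \oo, (2 : R) ^- K <= e.
    by move: (@cvg_pow2V R) => /cvgr_le; apply.
  near=> n; rewrite /u; case: xgetP => [s _ [Ts nk sk]|_]; last first.
    by rewrite subrr normr0 ltW.
  apply: le_trans (time_cell_near (ixP _) nk sk) _.
  apply: KP => /=; rewrite -(trunc_expnK K (isT : (1 < 4)%N)).
  by apply: leq_trunc_log; near: n; exists (4 ^ K)%N.
- move=> k j jk njk.
  have kn : trunc_log 4 (4 ^ k + j) = k.
    apply: trunc_log_eq => //; rewrite leq_addr /= expnS mulSn ltn_add2l.
    by apply: leq_trans jk _; rewrite leq_pmull.
  exists (4 ^ k + j)%N.
    by apply: leq_trans (leq_addr _ _); apply/ltnW/ltn_expl.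
  have [s [Ts sj]] : T `&` time_cell k (ix k) j !=set0.
    by apply/set0P/eqP => T0; exact: njk.
  have : target (4 ^ k + j)%N (u (4 ^ k + j)%N).
    by apply: xgetPex; exists s; rewrite /target/= kn addKn.
  by rewrite /target/= kn addKn => -[].
Unshelve. all: by end_near. Qed.

Definition rarely_hit T (ix : nat -> nat) : set R :=
  \bigcup_K \bigcap_(k in [set k | (K <= k)%N]) missed_space T k (ix k).

Lemma measurable_rarely_hit T ix : measurable (rarely_hit T ix).
Proof.
apply: bigcup_measurable => K _; apply: bigcap_measurable => [|k _].
  by exists K => /=.
exact: measurable_missed_space.
Qed.

(** Each of the intersections has measure 0, because density one makes the
    measure of the missed part arbitrarily small for large [k]. *)
Lemma measure_rarely_hit T t (ix : nat -> nat) : density_one T t ->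
  (forall k, (ix k < 2 ^ k)%N) ->
  (forall k, 0 <= 2 ^+ k * t - (ix k)%:R <= 1) ->
  mu (rarely_hit T ix) = 0%E.
Proof.
move=> dT ix2 ixP; apply/eqP; rewrite -measure_le0.
pose F K := \bigcap_(k in [set k | (K <= k)%N]) missed_space T k (ix k).
apply: (@le_trans _ _ (\sum_(0 <= K <oo) mu (F K))%E).
  apply: (measure_sigma_subadditive mu) => // [K|].
    apply: bigcap_measurable => [|k _]; first by exists K => /=.
    exact: measurable_missed_space.
  exact: measurable_rarely_hit.
rewrite eseries0// => K _ _; apply/eqP; rewrite -measure_le0.
apply/lee_addgt0Pr => e e0; rewrite add0e.
have e40 : 0 < e / 4 by rewrite divr_gt0.
have [k0 _ /(_ (maxn K k0) (leq_maxr _ _))] := density_scale dT e40.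
move/(measure_missed_space_le (ix2 _) (ixP _)); rewrite mulrC divfK//.
apply: le_trans; apply: le_lebesgue_measure => x; apply; exact: leq_maxl.
Qed.

(** At infinitely many scales [k], some term of the sequence puts [x] in a
    strip of index [k]: the values at [x] come back above every number less
    than 1, while the limit is less than 1. *)
Lemma profile_not_cvg T t x (u : nat -> R) (ix : nat -> nat) :
  (forall k, (ix k < 2 ^ k)%N) ->
  (forall k j, (j < 4 ^ k)%N -> ~ missed_cells T k (ix k) j ->
     exists2 n, (k <= n)%N & time_cell k (ix k) j (u n)) ->
  `[0, 1[%classic x ->
  ~ lim_sup_set (strip ^~ t) x -> ~ rarely_hit T ix x ->
  ~ (profile (u n) x @[n --> \oo] --> profile t x).
Proof.
move=> ix2 hit; rewrite /= in_itv/= => /andP[x0 x1] /profile_lt1 ft1 nrare fcvg.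
pose c := (profile t x + 1) / 2.
have [ftc c1] : profile t x < c /\ c < 1 by rewrite /c; split; lra.
have [N1 _ N1P] := cvgr_lt _ fcvg _ ftc.
have [N2 _ N2P] := cvgr_gt _ level_cvg1 _ c1.
have [k Nk xk] : exists2 k, (maxn N1 N2 <= k)%N & ~ missed_space T k (ix k) x.
  apply: contra_notP nrare => nk; exists (maxn N1 N2) => // k /= Nk.
  by apply: contra_notP nk => xk; exists k.
have P0 : 0 < (4 : R) ^+ k by rewrite exprn_gt0.
have x40 : 0 <= x * 4 ^+ k by rewrite mulr_ge0// ltW.
pose j := Num.truncn (x * 4 ^+ k).
have xj : space_cell k j x.
  have := truncn_itv x40; rewrite -/j /space_cell/= in_itv/=.
  by rewrite ler_pdivrMr// ltr_pdivlMr.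
have jk : (j < 4 ^ k)%N.
  rewrite -(ltr_nat R) natrX; apply: (@le_lt_trans _ _ (x * 4 ^+ k)).
    by rewrite truncn_le.
  by rewrite gtr_pMl.
have [|n kn un] := hit k j jk; first by move=> jm; apply: xk; exists j.
have := level_le_profile (time_cell_strip (ix2 k) un xj).
move: (N1P n); rewrite /= (leq_trans _ kn) ?(leq_trans _ Nk) ?leq_maxl// => /(_ isT).
move: (N2P k); rewrite /= (leq_trans _ Nk) ?leq_maxr// => /(_ isT).
by move=> ck /lt_trans /(_ ck) + lp; rewrite ltNge lp.
Qed.

End sequence_of_times.

Theorem theorem4p1 (R : realType) (p : R) (p1 : (1 <= p%:E)%E) :
  exists f : R -> LfunType (@lambda01 R) p1,
    {within `[0, 1], continuous f} /\
    forall T : set R, T `<=` `[0, 1] -> lebesgue_measurable T ->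
      (0 < completed_lebesgue_measure T)%E ->
      forall t : R, T t -> density_one T t ->
        exists u : nat -> R,
          [/\ forall n, T (u n),
              u @ \oo --> t &
              lambda01 [set x | `[0, 1]%classic x /\
                ~ (f (u n) x @[n --> \oo] --> f t x)] = 1%E].
Proof.
exists (profile_Lfun p1); split.
  exact/continuous_subspaceT/profile_Lfun_continuous.
move=> T T01 _ _ t Tt dT.
have /choice[ix ixP] : forall k, exists i,
    (i < 2 ^ k)%N /\ 0 <= (2 : R) ^+ k * t - i%:R <= 1.
  by move=> k; have [i ? ?] := dyadic_index k (T01 _ Tt); exists i.
have ix2 k : (ix k < 2 ^ k)%N by have [] := ixP k.
have ix01 k : 0 <= (2 : R) ^+ k * t - (ix k)%:R <= 1 by have [] := ixP k.
have [u [Tu ut hit]] := hitting_sequence Tt ix01.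
exists u; split=> //.
set A := [set x | _].
pose Z := lim_sup_set (strip ^~ t) `|` rarely_hit T ix.
have mZ1 : measurable (lim_sup_set (strip ^~ t)).
  apply: bigcap_measurable => [|n _]; first by exists 0%N.
  by apply: bigcup_measurable => k _; exact: measurable_strip.
have mZ : measurable Z.
  by apply: measurableU => //; exact: measurable_rarely_hit.
have Z0 : lebesgue_measure Z = 0%E.
  by rewrite measureU0//; [exact: measure_limsup_strip |
     exact: measurable_rarely_hit | exact: measure_rarely_hit dT _ _].
have I01 : lebesgue_measure (`[0, 1]%classic : set R) = 1%E.
  by rewrite lebesgue_measure_itv_bounded// subr0.
apply/eqP; rewrite eq_le; apply/andP; split.
  by rewrite -I01; apply: le_lebesgue_measure; exact: subIsetr.
have <- : lebesgue_measure (`[0, 1[%classic `\` Z : set R) = 1%E.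
  rewrite measureD//=; last first.
    by rewrite lebesgue_measure_itv_bounded// ltry.
  have -> : lebesgue_measure (`[0, 1[%classic `&` Z : set R) = 0%E.
    apply/eqP; rewrite -measure_le0 -Z0.
    by apply: le_lebesgue_measure; exact: subIsetr.
  by rewrite sube0 lebesgue_measure_itv_bounded// subr0.
apply: le_lebesgue_measure => x [x01 /not_orP[n1 n2]].
have x01' : `[0, 1]%classic x.
  by move: x01; rewrite /= !in_itv/= => /andP[-> /ltW].
split=> //; split=> //.
exact: (profile_not_cvg ix2 hit).
Qed.
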